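(* Let $G$ range over all cycle-free simple graphs (forests) with $n$ vertices and $m<n$ edges and without isolated vertices (assuming at least one such graph exists). Then $\max q(G)$ is attained by a graph all of whose connected components $T_i$ are paths, and whose components have numbers of vertices $n(T_i)$ that are as equal as possible, i.e. $$|n(T_i)-n(T_j)|\leq 1\quad\text{for all } i,j.$$
   Context: For a finite simple graph $G=(V,E)$, associate a variable $x_v$ over $\mathbb{F}_2$ with each vertex $v$. A randomly generated system on $G$ has, for each edge $vw\in E$, one equation $f_{vw}(x_v,x_w)=0$, where the $f_{vw}$ are chosen independently and uniformly at random among all $16$ Boolean polynomials over $\mathbb{F}_2$ in the two variables $x_v,x_w$ (equivalently, all functions $\mathbb{F}_2^2\to\mathbb{F}_2$). $q(G)$ denotes the probability that this system is consistent, i.e. has a solution in $\mathbb{F}_2^{V}$. *)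

(* Defs.v *)
From mathcomp Require Import all_boot all_order all_algebra.

Set Implicit Arguments.
Unset Strict Implicit.
Unset Printing Implicit Defensive.

Import Order.TTheory GRing.Theory Num.Theory.

Record sgraph := SGraph {
  vertex :> finType;
  adj : rel vertex;
  adj_sym : symmetric adj;
  adj_irrefl : irreflexive adj }.

(* Each edge occurs exactly once, as the ordered pair of its endpoints in the
   order of the enumeration of the vertex type.  Since the function attached to
   an edge is uniform among all functions of two arguments, the choice of
   orientation does not affect the distribution of the random system. *)
Definition edge (G : sgraph) : finType :=
  {vw : G * G | adj vw.1 vw.2 && (enum_rank vw.1 < enum_rank vw.2)}.

Definition edge_fst (G : sgraph) (e : edge G) : G := (val e).1.
Definition edge_snd (G : sgraph) (e : edge G) : G := (val e).2.

Definition system (G : sgraph) : finType :=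
  {ffun edge G -> {ffun 'F_2 * 'F_2 -> 'F_2}}.

Definition consistent (G : sgraph) (f : system G) : bool :=
  [exists x : {ffun G -> 'F_2},
    [forall e : edge G, f e (x (edge_fst e), x (edge_snd e)) == 0%R]].

(* Independent uniform choices on the edges amount to the uniform distribution
   on the finite set of all systems. *)
Definition q (G : sgraph) : rat :=
  (#|[set f : system G | consistent f]|%:R / #|system G|%:R)%R.

(* [ucycle] also accepts the closed walk [:: v; w] along a single edge, which
   is not a cycle of the graph. *)
Definition cycle_free (G : sgraph) : Prop :=
  forall c : seq G, ucycle (@adj G) c -> size c <= 2.

Definition no_isolated (G : sgraph) : Prop :=
  forall v : G, exists w : G, adj v w.

Definition components (G : sgraph) : {set {set G}} :=
  [set [set w | connect (@adj G) v w] | v : G].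

(* The subgraph induced on [T] is a path: its vertices can be listed without
   repetition so that adjacency is exactly being consecutive in the list. *)
Definition induces_path (G : sgraph) (T : {set G}) : Prop :=
  exists s : seq G,
    [/\ uniq s, s =i T &
        {in T &, forall v w : G,
           adj v w = (index w s == (index v s).+1)
                  || (index v s == (index w s).+1)}].

Definition admissible (n m : nat) (G : sgraph) : Prop :=
  [/\ #|G| = n, #|edge G| = m, cycle_free G & no_isolated G].

(* Main.v *)
(** Root every tree of the random system and follow the pair (p, r), where p is
    the probability that a given value of the root extends to the whole tree and
    r the probability that both values do.  Attaching a new root by an edge acts
    on the pair linearly, gluing trees at a common root multiplies pairs, and a
    tree is consistent with probability 2 p - r.  Induction along leaf
    eliminations shows that p and 2 p - r are at most the corresponding numbers
    for a path with the same number of edges rooted at its end, so a forest is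
    at most as good as a union of paths with the same component sizes.  The
    consistency probability of a path is log-concave in its length, which makes
    equal lengths optimal. *)
Require Import Defs.
From mathcomp Require Import all_boot all_order all_algebra.
From mathcomp Require Import ring lra zify.

Set Implicit Arguments.
Unset Strict Implicit.
Unset Printing Implicit Defensive.

Import Order.TTheory GRing.Theory Num.Theory.

(** * Random systems on paths and the log-concavity of their consistency probability *)

Section Paths.
Local Open Scope ring_scope.

(* The root of a random rooted tree may take each of the two values with the
   same probability, the first component; the second component is the
   probability that both values extend to the whole tree.  This is how the pair
   changes when a new root is attached to the old one by a random constraint. *)
Definition edge_step (a : rat * rat) : rat * rat :=
  (a.1 - a.2 / 4%:R, a.1 / 2%:R + a.2 / 16%:R).

Definition path_end (j : nat) : rat * rat := iter j edge_step (1, 1).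

(** Inclusion-exclusion over the two values of the root. *)
Definition path_prob (j : nat) : rat := 2%:R * (path_end j).1 - (path_end j).2.

Lemma path_endS j : path_end j.+1 = edge_step (path_end j).
Proof. by []. Qed.

Lemma path_end_bounds j :
  [/\ 0 < (path_end j).2, (path_end j).2 <= (path_end j).1
    & (path_end j).1 <= 2%:R * (path_end j).2].
Proof.
elim: j => [|j [r0 rp pr]]; first by split=> //=; lra.
by rewrite path_endS /edge_step /=; split; lra.
Qed.

(* Both sides are the consistency probability of one path, rooted at an end
   and at an inner vertex. *)
Lemma path_prob_split a b :
  path_prob (a + b) =
  2%:R * ((path_end a).1 * (path_end b).1) - (path_end a).2 * (path_end b).2.
Proof.
elim: b a => [|b IHb] a; first by rewrite addn0 /path_prob /= !mulr1.
rewrite addnS -addSn IHb !path_endS /edge_step /=; field; by [].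
Qed.

(** Cayley-Hamilton for the linear map [edge_step], of trace 17/16 and determinant 3/16. *)
Lemma path_end_rec j :
  (path_end j.+2).1 = 17%:R / 16%:R * (path_end j.+1).1 - 3%:R / 16%:R * (path_end j).1.
Proof. by rewrite !path_endS /edge_step /=; field. Qed.

(** As functions of [b] both sides obey [path_end_rec], hence so does their difference [d]. If [d]
    drops by at most a factor 2 in one step, the next value is at least 17/16 - 3/8 = 11/16 of its
    predecessor, so [d] stays nonnegative. *)
Lemma path_end_supermul a b :
  (path_end a).1 * (path_end b).1 <= (path_end (a + b)).1.
Proof.
pose d b := (path_end (a + b)).1 - (path_end a).1 * (path_end b).1.
suff: 0 <= d b /\ d b / 2%:R <= d b.+1 by rewrite /d; lra.
elim: b => [|b [d0 d1]].
  have [_ ? _] := path_end_bounds a.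
  by rewrite /d addn0 addn1 path_endS /=; lra.
suff: d b.+2 = 17%:R / 16%:R * d b.+1 - 3%:R / 16%:R * d b by lra.
by rewrite /d !addnS !path_end_rec; field.
Qed.

Lemma path_prob_gt0 j : 0 < path_prob j.
Proof. by have [? ? _] := path_end_bounds j; rewrite /path_prob; lra. Qed.

(** The defect is a Casoratian of the second-order recurrence, so each step multiplies it by 3/16
    and its sign is decided at [j = 0]. *)
Lemma path_prob_log_concave j :
  path_prob j * path_prob j.+2 <= path_prob j.+1 ^+ 2.
Proof.
have rec i : path_prob i.+2 =
    17%:R / 16%:R * path_prob i.+1 - 3%:R / 16%:R * path_prob i.
  by rewrite /path_prob !path_endS /edge_step /=; field.
elim: j => [|j IHj]; first by rewrite /path_prob /= /edge_step /=; lra.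
suff: path_prob j.+2 ^+ 2 - path_prob j.+1 * path_prob j.+3 =
  3%:R / 16%:R * (path_prob j.+1 ^+ 2 - path_prob j * path_prob j.+2) by lra.
by rewrite (rec j.+1) (rec j); field.
Qed.

Lemma path_prob_ratio_decr i d :
  path_prob (i + d).+1 * path_prob i <= path_prob i.+1 * path_prob (i + d).
Proof.
elim: d => [|d IHd]; first by rewrite addn0.
have h := path_prob_log_concave (i + d); rewrite addnS.
have [p0 p1] := (path_prob_gt0 (i + d), path_prob_gt0 (i + d).+1).
have pi := path_prob_gt0 i.
rewrite -(ler_pM2l p0); nra.
Qed.

(** A log-concave sequence lies below the geometric progression through its terms at [a] and [a.+1].
    Powers of [rho] on both sides avoid the possibly negative exponent [c - a]. *)
Lemma path_prob_tangent a c (rho := path_prob a.+1 / path_prob a) :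
  path_prob c * rho ^+ a <= path_prob a * rho ^+ c.
Proof.
have pa := path_prob_gt0 a.
have rho0 : 0 < rho by rewrite divr_gt0 ?path_prob_gt0.
have [le_ac|/ltnW le_ca] := leqP a c.
  rewrite -(subnKC le_ac); elim: (c - a)%N => [|d IHd]; first by rewrite addn0.
  rewrite addnS exprS; apply: (@le_trans _ _ (rho * (path_prob (a + d) * rho ^+ a))).
    rewrite mulrA ler_pM2r ?exprn_gt0 // /rho mulrAC ler_pdivlMr //.
    exact: path_prob_ratio_decr.
  by rewrite [leRHS]mulrCA ler_pM2l.
rewrite -{1}(subKn le_ca); have := leq_subr c a; rewrite -{3}(subKn le_ca).
elim: (a - c)%N => [|d IHd] le_da; first by rewrite subn0.
have Ed : (a - d = (a - d.+1).+1)%N by lia.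
have := IHd (ltnW le_da); rewrite Ed exprS mulrCA => h.
rewrite -(ler_pM2l rho0) (le_trans _ h) // mulrA ler_pM2r ?exprn_gt0 //.
rewrite /rho mulrAC ler_pdivrMr //.
by have := path_prob_ratio_decr (a - d.+1) d.+1; rewrite subnK.
Qed.

(** The quotients form the most equal partition of [m] into [K] parts. Shifting the window trades
    [m %/ K] for [(m + K) %/ K], which is one larger. *)
Lemma sum_divn_interval K m : (0 < K)%N ->
  (\sum_(m <= i < m + K) i %/ K = m)%N.
Proof.
move=> K0; elim: m => [|m IHm].
  by rewrite big_nat big1 // => i /andP[_ ?]; rewrite divn_small.
have := IHm; rewrite big_ltn ?addSn; last by lia.
rewrite big_nat_recr /=; last by lia.
rewrite divnDr // divnn K0; lia.
Qed.

(** Take the tangent progression at [a], the integer part of the mean. Balanced parts equal [a] or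
    [a.+1], where the tangent bound is an equality, and the exponents of [rho] have the same total
    for both products. *)
Lemma prod_path_prob_balanced (s : seq nat) : (0 < size s)%N ->
  \prod_(c <- s) path_prob c <=
  \prod_(sumn s <= i < sumn s + size s) path_prob (i %/ size s).
Proof.
set K := size s; set m := sumn s => K0.
pose a := (m %/ K)%N; pose rho := path_prob a.+1 / path_prob a.
have pa := path_prob_gt0 a.
have rho0 : 0 < rho by rewrite divr_gt0 ?path_prob_gt0.
rewrite -(ler_pM2r (exprn_gt0 (a * K) rho0)).
have -> : (\prod_(m <= i < m + K) path_prob (i %/ K)) * rho ^+ (a * K) =
    path_prob a ^+ K * rho ^+ m.
  transitivity (\prod_(m <= i < m + K) (path_prob (i %/ K) * rho ^+ a)).
    by rewrite big_split /= prodr_const_nat addKn exprM.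
  transitivity (\prod_(m <= i < m + K) (path_prob a * rho ^+ (i %/ K))).
    apply: eq_big_nat => i /andP[le_mi lt_im].
    have a_i : (a <= i %/ K)%N by apply: leq_div2r.
    have i_a : (i %/ K <= a.+1)%N.
      by rewrite -ltnS ltn_divLR // (leq_trans lt_im) // !mulSn addnA;
         have := ltn_ceil m K0; rewrite mulSn -/a; lia.
    have [->|->] : (i %/ K = a)%N \/ (i %/ K = a.+1)%N by lia.
      by [].
    by rewrite exprS mulrA /rho (mulrC (path_prob a)) mulfVK ?gt_eqF.
  rewrite big_split /= prodr_const_nat addKn; congr (_ * _).
  by rewrite -expr_sum sum_divn_interval.
rewrite /K /m; elim: (s) => [|c t IHt] /=; first by rewrite big_nil muln0.
rewrite big_cons mulnS exprD exprS exprD mulrACA [leRHS]mulrACA.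
apply: ler_pM => //; last exact: path_prob_tangent.
  by rewrite mulr_ge0 ?exprn_ge0 ?ltW ?path_prob_gt0.
by rewrite mulr_ge0 ?exprn_ge0 ?prodr_ge0 ?(ltW rho0) // => i _; rewrite ltW ?path_prob_gt0.
Qed.
End Paths.

(** * Comparison of rooted trees with paths rooted at an end *)

Section Domination.
Local Open Scope ring_scope.

(* Equivalently, 2 p - s r is at most its value at the end of a path with j
   edges for every s in [0, 1]: p and 2 p - r are the two extreme cases. *)
Definition path_dominated (j : nat) (a : rat * rat) : Prop :=
  [/\ 0 <= a.2, a.2 <= a.1, a.1 <= (path_end j).1
    & 2%:R * a.1 - a.2 <= path_prob j].

(** Both sides are affine in [s], so the cases [s = 0] and [s = x] suffice. In use, [x] and [s] are
    the pair of another tree glued at the root. *)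
Lemma path_dominated_slope j a s x : path_dominated j a -> 0 <= s <= x ->
  2%:R * (x * a.1) - s * a.2 <=
  2%:R * (x * (path_end j).1) - s * (path_end j).2.
Proof.
case: a => p r [/= r0 rp pj qj] /andP[s0 sx].
by rewrite /path_prob in qj; nra.
Qed.

(** Both new quantities, p - r/4 and 3p/2 - 9r/16, are nonnegative combinations of p and 2p - r. *)
Lemma path_dominated_step j a :
  path_dominated j a -> path_dominated j.+1 (edge_step a).
Proof.
case: a => p r [/= r0 rp pj qj]; rewrite /path_prob in qj.
by split; rewrite /path_prob ?path_endS /edge_step /=; lra.
Qed.

Lemma path_dominated_mul i j a b : path_dominated i a -> path_dominated j b ->
  path_dominated (i + j) (a.1 * b.1, a.2 * b.2).
Proof.
move=> Da Db; have [a0 aa ai _] := Da; have [b0 bb bj _] := Db.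
have [r0 rp _] := path_end_bounds j.
split=> /=; first exact: mulr_ge0.
- by apply: ler_pM.
- apply: le_trans (path_end_supermul i j); apply: ler_pM => //; lra.
- rewrite path_prob_split.
  (* The factors are replaced by paths one at a time, first [b], then [a]. *)
  apply: le_trans (_ : 2%:R * (a.1 * (path_end j).1) - a.2 * (path_end j).2 <= _).
    by apply: path_dominated_slope; rewrite // a0.
  rewrite (mulrC a.1) (mulrC a.2) (mulrC (path_end i).1) (mulrC (path_end i).2).
  by apply: path_dominated_slope; rewrite // ltW.
Qed.

Lemma path_dominated1 : path_dominated 0 (1, 1).
Proof. by rewrite /path_dominated /path_prob /=; split; lra. Qed.

End Domination.

(** * Averages over one random constraint *)

Section Constraints.
Local Open Scope ring_scope.

Notation constraint := {ffun 'F_2 * 'F_2 -> 'F_2}.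

(* A set of values of a variable, as the pair of the truth values of 0 and 1
   belonging to it. *)
Definition allows (c : bool * bool) (x : 'F_2) : bool :=
  if x == 0 then c.1 else c.2.

Definition allows_and (c d : bool * bool) : bool * bool :=
  (c.1 && d.1, c.2 && d.2).

Definition extendable (h : 'F_2 -> 'F_2 -> bool) (c : bool * bool) :=
  (h 0 0 && c.1 || h 0 1 && c.2, h 1 0 && c.1 || h 1 1 && c.2).

(** The flag [b] tells whether [y] belongs to the first endpoint of the edge. *)
Definition related (b : bool) (g : constraint) (y x : 'F_2) : bool :=
  g (if b then (y, x) else (x, y)) == 0.

(* The expectations of the indicators that 0, 1, and both are allowed. *)
Definition weight : Type := (rat * rat * rat)%type.

Definition indicator (c : bool * bool) : weight :=
  (c.1%:R, c.2%:R, (c.1 && c.2)%:R).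

Definition weight_mul (a b : weight) : weight :=
  (a.1.1 * b.1.1, a.1.2 * b.1.2, a.2 * b.2).

(** [edge_step] for a vertex whose two values may have different probabilities; one, respectively
    two, allowed values extend a given new value with probability 1/2, respectively 3/4. *)
Definition weight_step (a : weight) : weight :=
  let p := (a.1.1 + a.1.2) / 2%:R - a.2 / 4%:R in
  (p, p, (a.1.1 + a.1.2) / 4%:R + a.2 / 16%:R).

Definition nonempty_prob (a : weight) : rat := a.1.1 + a.1.2 - a.2.

Lemma F2_cases (x : 'F_2) : x = 0 \/ x = 1.
Proof. by case: x => [[|[|//]] hx]; [left|right]; apply: val_inj. Qed.

Lemma card_constraint : #|{: constraint}| = 16.
Proof. by rewrite card_ffun card_prod !card_ord. Qed.

(** An element of F_2 is determined by whether it vanishes, so a uniform constraint amounts to four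
    fair bits. *)
Lemma sum_constraint (b : bool) (Phi : bool -> bool -> bool -> bool -> rat) :
  \sum_(g : constraint)
     Phi (related b g 0 0) (related b g 0 1) (related b g 1 0) (related b g 1 1) =
  \sum_(a0 : bool) \sum_(a1 : bool) \sum_(a2 : bool) \sum_(a3 : bool)
     Phi a0 a1 a2 a3.
Proof.
pose tb (x : 'F_2) (t : bool * bool) := if x == 0 then t.1 else t.2.
pose mk (t : bool * bool * (bool * bool)) : constraint :=
  [ffun yx => let: (y, x) := if b then yx else (yx.2, yx.1) in
     if (if y == 0 then tb x t.1 else tb x t.2) then 0 else 1].
pose dk (g : constraint) : bool * bool * (bool * bool) :=
  ((related b g 0 0, related b g 0 1), (related b g 1 0, related b g 1 1)).
have mkK : cancel mk dk.
  by case=> [[[] []] [[] []]]; rewrite /dk /related /mk; case: (b); rewrite !ffunE.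
have F2E (u : 'F_2) : (if u == 0 then 0 else 1) = u.
  by case: (F2_cases u) => ->.
have dkK : cancel dk mk.
  move=> g; apply/ffunP=> -[y x]; rewrite ffunE /dk /related /tb.
  by case: (b); case: (F2_cases y) => ->; case: (F2_cases x) => -> /=;
     exact: F2E.
rewrite (reindex mk) /=; last by apply: onW_bij; exists dk.
rewrite (eq_bigr (fun t : bool * bool * (bool * bool) =>
   Phi t.1.1 t.1.2 t.2.1 t.2.2)); last first.
  by move=> t _; have := mkK t; case: t => [[a0 a1] [a2 a3]]; rewrite /dk => -[-> -> -> ->].
rewrite pair_bigA /= (eq_bigr (fun p : bool * bool =>
  \sum_(u : bool * bool) Phi p.1 p.2 u.1 u.2)) => [|p _].
  by rewrite pair_bigA.
by rewrite pair_bigA.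
Qed.

(** Here the coefficients of [weight_step] are justified, by checking the four possible sets [c];
    the factor 16 counts the constraints. *)
Lemma average_extendable (b : bool) (c : bool * bool) :
  [/\ \sum_(g : constraint) (indicator (extendable (related b g) c)).1.1 =
        16%:R * (weight_step (indicator c)).1.1,
      \sum_(g : constraint) (indicator (extendable (related b g) c)).1.2 =
        16%:R * (weight_step (indicator c)).1.2
    & \sum_(g : constraint) (indicator (extendable (related b g) c)).2 =
        16%:R * (weight_step (indicator c)).2].
Proof.
split; rewrite /indicator /extendable /weight_step /=.
- rewrite (sum_constraint b (fun x y z t => (x && c.1 || y && c.2)%:R)).
  by rewrite !big_bool /=; case: c => [[] []] /=; field.
- rewrite (sum_constraint b (fun x y z t => (z && c.1 || t && c.2)%:R)).
  by rewrite !big_bool /=; case: c => [[] []] /=; field.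
- rewrite (sum_constraint b (fun x y z t =>
    ((x && c.1 || y && c.2) && (z && c.1 || t && c.2))%:R)).
  by rewrite !big_bool /=; case: c => [[] []] /=; field.
Qed.

Lemma indicator_and c d :
  indicator (allows_and c d) = weight_mul (indicator c) (indicator d).
Proof.
case: c d => [[] []] [[] []]; rewrite /indicator /weight_mul /=;
  by rewrite ?mulr1 ?mulr0 ?mul0r.
Qed.

Lemma nonempty_indicator c : nonempty_prob (indicator c) = (c.1 || c.2)%:R.
Proof. by case: c => [[] []]; rewrite /nonempty_prob /=; lra. Qed.

End Constraints.

(** * Leaf elimination for one system and on average *)

Section Elimination.
Local Open Scope ring_scope.

Variables (V E : finType) (ends : E -> V * V).

Definition joins (e : E) (u v : V) : bool :=
  (ends e == (u, v)) || (ends e == (v, u)).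

(* An entry (u, Some (v, e)) eliminates the leaf u through its edge e to v; an
   entry (u, None) eliminates u as an isolated vertex. *)
Implicit Types L : seq (V * option (V * E)).

Definition edges_of L : seq E := pmap (fun s => omap snd s.2) L.

Fixpoint elimination L : bool :=
  if L is (u, o) :: L' then
    [&& u \notin unzip1 L',
        if o is Some (v, e) then (v \in unzip1 L') && joins e u v else true
      & elimination L']
  else true.

Definition upd T (c : V -> T) (v : V) (t : T) : V -> T :=
  fun x => if x == v then t else c x.

(** Message passing: a leaf hands its weight on to its neighbour, and the last vertex of each tree
    contributes the consistency probability of that tree. *)
Fixpoint value L (w : V -> weight) : rat :=
  match L with
  | [::] => 1
  | (u, None) :: L' => nonempty_prob (w u) * value L' w
  | (u, Some (v, _)) :: L' =>
      value L' (upd w v (weight_mul (w v) (weight_step (w u))))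
  end.

Notation constraint := {ffun 'F_2 * 'F_2 -> 'F_2}.
Implicit Type f : {ffun E -> constraint}.

(** The same recursion for a fixed system, where [c] keeps the values still possible at each
    vertex. *)
Fixpoint eliminable f L (c : V -> bool * bool) : bool :=
  match L with
  | [::] => true
  | (u, None) :: L' => ((c u).1 || (c u).2) && eliminable f L' c
  | (u, Some (v, e)) :: L' =>
      eliminable f L' (upd c v (allows_and (c v)
        (extendable (related ((ends e).1 == v) (f e)) (c u))))
  end.

Lemma allows_andE c d x : allows (allows_and c d) x = allows c x && allows d x.
Proof. by rewrite /allows /allows_and; case: eqP. Qed.

Lemma allowsP c : reflect (exists x, allows c x) (c.1 || c.2).
Proof.
apply: (iffP orP) => [[h|h]|[x]]; [by exists 0 | by exists 1 |].
by rewrite /allows; case: eqP => _ h; [left | right].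
Qed.

Lemma extendableP h c y :
  reflect (exists x, allows c x && h y x) (allows (extendable h c) y).
Proof.
apply: (iffP idP).
  by rewrite /allows /extendable; case: (F2_cases y) => -> /= /orP[]/andP[hh cc];
    [exists 0 | exists 1 | exists 0 | exists 1]; rewrite /= ?hh ?cc.
move=> [x]; rewrite /allows /extendable.
by case: (F2_cases y) => ->; case: (F2_cases x) => -> /= /andP[-> ->];
   rewrite ?orbT.
Qed.

Lemma edges_of_ends L e : elimination L -> e \in edges_of L ->
  ((ends e).1 \in unzip1 L) && ((ends e).2 \in unzip1 L).
Proof.
elim: L => //= -[u [[v e']|]] L IHL /=.
  move=> /and3P[_ /andP[vL je] eL]; rewrite inE => /orP[/eqP->|/(IHL eL)].
    by case/orP: je => /eqP-> /=; rewrite !inE eqxx vL orbT.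
  by rewrite !inE => /andP[-> ->]; rewrite !orbT.
by move=> /andP[_ eL] /(IHL eL); rewrite !inE => /andP[-> ->]; rewrite !orbT.
Qed.

Lemma edges_of_fresh L u v e : elimination L -> u \notin unzip1 L ->
  joins e u v -> e \notin edges_of L.
Proof.
move=> eL uL je; apply: contra uL => /(edges_of_ends eL).
by case/orP: je => /eqP-> /= /andP[].
Qed.

Lemma eliminableP f L c : elimination L ->
  reflect (exists x : {ffun V -> 'F_2},
             {in unzip1 L, forall v, allows (c v) (x v)} /\
             {in edges_of L, forall e, f e (x (ends e).1, x (ends e).2) == 0})
          (eliminable f L c).
Proof.
elim: L c => [|[u [[v e]|]] L IHL] c /=.
- by move=> _; apply: ReflectT; exists [ffun=> 0].
- move=> /and3P[uL /andP[vL je] eL].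
  have neq_vu : v != u by apply: contra uL => /eqP<-.
  have eE := edges_of_fresh eL uL je.
  have relE (x : V -> 'F_2) : related ((ends e).1 == v) (f e) (x v) (x u) =
      (f e (x (ends e).1, x (ends e).2) == 0).
    rewrite /related; case/orP: je => /eqP-> /=; last by rewrite eqxx.
    by rewrite (eq_sym u) (negPf neq_vu).
  apply: (iffP (IHL _ eL)) => -[x [xc xe]]; last first.
    exists x; split=> [z zL|z zL]; last by apply: xe; rewrite inE zL orbT.
    rewrite /upd; case: eqP => [->|_]; last by apply: xc; rewrite inE zL orbT.
    rewrite allows_andE xc ?inE ?vL ?orbT //=; apply/extendableP.
    by exists (x u); rewrite xc ?inE ?eqxx //= relE xe // inE eqxx.
  (* Conversely, a solution on [L] leaves a suitable value [t] for the leaf; setting [u] to [t] is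
     harmless because no remaining edge meets [u]. *)
  have := xc v vL; rewrite /upd eqxx allows_andE => /andP[cv /extendableP[t /andP[ct ht]]].
  pose x' := [ffun z => if z == u then t else x z].
  have x'E z : z \in unzip1 L -> x' z = x z.
    by move=> zL; rewrite ffunE ifN //; apply: contra uL => /eqP<-.
  have x'u : x' u = t by rewrite ffunE eqxx.
  exists x'; split=> z; rewrite inE => /orP[/eqP->|zL].
  + by rewrite x'u.
  + rewrite x'E //; have := xc z zL; rewrite /upd.
    by case: eqP => [->|//]; rewrite allows_andE => /andP[].
  + by rewrite -relE x'u x'E.
  + by have /andP[z1 z2] := edges_of_ends eL zL; rewrite !x'E // xe.
- move=> /andP[uL eL]; apply: (iffP andP) => [[/allowsP[t ct] /(IHL _ eL)[x [xc xe]]]|[x [xc xe]]].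
    exists [ffun z => if z == u then t else x z]; split=> z.
      rewrite inE ffunE; case: eqP => [->//|_] /= zL; exact: xc.
    move=> zL; have /andP[z1 z2] := edges_of_ends eL zL.
    rewrite !ffunE !ifN; first exact: xe.
      by apply: contra uL => /eqP<-.
    by apply: contra uL => /eqP<-.
  split; first by apply/allowsP; exists (x u); rewrite xc // inE eqxx.
  by apply/(IHL _ eL); exists x; split=> // z zL; apply: xc; rewrite inE zL orbT.
Qed.

Lemma eq_value L w w' : elimination L -> {in unzip1 L, w =1 w'} ->
  value L w = value L w'.
Proof.
elim: L w w' => [|[u [[v e]|]] L IHL] w w' //=.
  move=> /and3P[uL /andP[vL je] eL] ww; apply: IHL => // z zL; rewrite /upd.
  by case: eqP => _; rewrite ?ww // !inE ?zL ?vL ?eqxx ?orbT.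
move=> /andP[uL eL] ww; rewrite ww ?inE ?eqxx //; congr (_ * _); apply: IHL => //.
by move=> z zL; rewrite ww // inE zL orbT.
Qed.

(** Linearity in the weight of a single vertex lets an average over one constraint pass inside
    [value]. *)
Lemma value_linear L w v : elimination L -> v \in unzip1 L ->
  exists a : weight, forall t : weight,
    value L (upd w v t) = a.1.1 * t.1.1 + a.1.2 * t.1.2 + a.2 * t.2.
Proof.
elim: L w v => [|[u [[u' e]|]] L IHL] w v //= .
  move=> /and3P[uL /andP[u'L je] eL] vL.
  have neq : u' != u by apply: contra uL => /eqP<-.
  have [Evu|neq_vu] := eqVneq v u.
    have [a Ha] := IHL w u' eL u'L.
    pose b := weight_mul a (w u').
    (* The transposed matrix of [weight_step] applied to [b]. *)
    exists (b.1.1 / 2%:R + b.1.2 / 2%:R + b.2 / 4%:R,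
            b.1.1 / 2%:R + b.1.2 / 2%:R + b.2 / 4%:R,
            - b.1.1 / 4%:R - b.1.2 / 4%:R + b.2 / 16%:R) => t.
    transitivity (value L (upd w u' (weight_mul (w u') (weight_step t)))).
      apply: eq_value => // z zL; rewrite /upd Evu eqxx (negPf neq).
      by case: eqP => // _; rewrite ifN //; apply: contra uL => /eqP<-.
    by rewrite Ha /b /weight_mul /weight_step /=; field.
  have vL' : v \in unzip1 L by move: vL; rewrite inE (negPf neq_vu).
  have [Evu'|neq_vu'] := eqVneq v u'.
    have [a Ha] := IHL w u' eL u'L.
    exists (weight_mul a (weight_step (w u))) => t.
    transitivity (value L (upd w u' (weight_mul t (weight_step (w u))))).
      apply: eq_value => // z zL; rewrite /upd Evu' eqxx.
      by rewrite (eq_sym u) (negPf neq); case: eqP.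
    by rewrite Ha /weight_mul /=; ring.
  pose s := weight_mul (w u') (weight_step (w u)).
  have [a Ha] := IHL (upd w u' s) v eL vL'.
  exists a => t; rewrite -Ha; apply: eq_value => // z zL; rewrite /upd.
  rewrite (eq_sym u' v) (negPf neq_vu') (eq_sym u v) (negPf neq_vu).
  by case: eqP => [->|//]; rewrite (eq_sym u') (negPf neq_vu').
move=> /andP[uL eL] vL; have [Evu|neq_vu] := eqVneq v u.
  pose a := value L w; exists (a, a, - a) => t.
  have -> : value L (upd w v t) = a.
    by apply: eq_value => // z zL; rewrite /upd Evu ifN //; apply: contra uL => /eqP<-.
  by rewrite /upd Evu eqxx /nonempty_prob /=; ring.
have vL' : v \in unzip1 L by move: vL; rewrite inE (negPf neq_vu).
have [a Ha] := IHL w v eL vL'.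
pose s := nonempty_prob (w u); exists (s * a.1.1, s * a.1.2, s * a.2) => t.
by rewrite Ha {1}/upd (eq_sym u v) (negPf neq_vu) /= -/s; ring.
Qed.

(** Redrawing one coordinate preserves uniformity: exchanging the old and the new value is an
    involution on pairs. *)
Lemma sum_resample (A : finType) (k : {ffun E -> A} -> rat) (e : E) :
  \sum_(f : {ffun E -> A}) \sum_(g : A) k [ffun x => if x == e then g else f x] =
  #|A|%:R * \sum_f k f.
Proof.
pose swap (p : {ffun E -> A} * A) := ([ffun x => if x == e then p.2 else p.1 x], p.1 e).
have swapK : involutive swap.
  case=> f g; congr (_, _); last by rewrite /= ffunE eqxx.
  by apply/ffunP=> x; rewrite !ffunE /=; case: eqP => [->|].
rewrite pair_bigA (reindex_inj (inv_inj swapK)) /=.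
rewrite (eq_bigr (fun p : {ffun E -> A} * A => k p.1)) => [|[f g] _].
  rewrite -(pair_bigA _ (fun (f : {ffun E -> A}) (g : A) => k f)) mulr_sumr.
  by apply: eq_bigr => f _; rewrite sumr_const mulr_natl.
by congr k; apply/ffunP=> x; rewrite !ffunE /=; case: eqP => [->|].
Qed.

Lemma eq_eliminable f f' L c : {in edges_of L, f =1 f'} ->
  eliminable f L c = eliminable f' L c.
Proof.
elim: L c => [|[u [[v e]|]] L IHL] c //= ff.
  rewrite ff ?inE ?eqxx //; apply: IHL => z zL.
  by apply: ff; rewrite inE zL orbT.
by rewrite IHL.
Qed.

Lemma sum_eliminable L c : elimination L ->
  \sum_(f : {ffun E -> constraint}) (eliminable f L c)%:R =
  #|{: {ffun E -> constraint}}|%:R * value L (indicator \o c).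
Proof.
elim: L c => [|[u [[v e]|]] L IHL] c /=.
- by rewrite sumr_const mulr1.
- move=> /and3P[uL /andP[vL je] eL].
  have fresh := edges_of_fresh eL uL je.
  pose b := (ends e).1 == v.
  pose c' (g : constraint) := allows_and (c v) (extendable (related b g) (c u)).
  (* The factor 16 pays for redrawing the constraint on [e]. With the new constraint [g] fixed, the
     induction hypothesis applies, since [e] does not occur in [L]; linearity then averages over
     [g]. *)
  apply: (@mulfI _ 16%:R) => //.
  have := sum_resample (fun f => (eliminable f L (upd c v (c' (f e))))%:R) e.
  rewrite card_constraint => <-; rewrite exchange_big /=.
  have [a Ha] := value_linear (indicator \o c) eL vL.
  transitivity (\sum_(g : constraint) #|{: {ffun E -> constraint}}|%:R *
                  value L (upd (indicator \o c) v (indicator (c' g)))).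
    apply: eq_bigr => g _; rewrite -[in RHS](@eq_value L (indicator \o upd c v (c' g))) //.
      rewrite -IHL //; apply: eq_bigr => f _; rewrite ffunE eqxx.
      congr (nat_of_bool _)%:R; apply: eq_eliminable => z zL; rewrite ffunE ifN //.
      by apply: contra fresh => /eqP<-.
    by move=> z _; rewrite /upd /=; case: eqP.
  rewrite -mulr_sumr mulrCA; congr (_ * _).
  under eq_bigr do rewrite Ha indicator_and.
  have [E1 E2 E3] := average_extendable b (c u).
  rewrite Ha /weight_mul /c'.
  move: (16%:R : rat) E1 E2 E3 => N E1 E2 E3.
  rewrite !big_split /= -!mulr_sumr /= E1 E2 E3 /=; ring.
- move=> /andP[uL eL]; rewrite nonempty_indicator mulrCA -IHL // mulr_sumr.
  by apply: eq_bigr => f _; rewrite -natrM mulnb.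
Qed.

End Elimination.

(** * Bounding a forest by a union of paths *)

Section ValueBound.
Local Open Scope ring_scope.

Definition symmetric_weight (a : rat * rat) : weight := (a.1, a.1, a.2).

Lemma symmetric_weight_step a :
  weight_step (symmetric_weight a) = symmetric_weight (edge_step a).
Proof.
by rewrite /weight_step /symmetric_weight /edge_step /=;
  congr (_, _, _); field.
Qed.

(** [k v] counts the edges already absorbed into [v], and [s] collects the edge counts of the
    finished trees. A leaf passes [k u] edges and the joining edge on to its neighbour; a last
    vertex closes its tree. *)
Lemma value_le_paths (V E : finType) (ends : E -> V * V)
    (L : seq (V * option (V * E))) (a : V -> rat * rat) (k : V -> nat) :
  elimination ends L -> {in unzip1 L, forall v, path_dominated (k v) (a v)} ->
  exists s : seq nat,
    [/\ (size s + size (edges_of L) = size L)%N,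
        (sumn s = \sum_(v <- unzip1 L) k v + size (edges_of L))%N
      & 0 <= value L (symmetric_weight \o a) <= \prod_(c <- s) path_prob c].
Proof.
elim: L a k => [|[u [[v e]|]] L IHL] a k /=.
- by exists [::]; split=> //=; rewrite !big_nil ?ler01 ?lexx.
- move=> /and3P[uL /andP[vL je] eL] dom.
  have du := dom u (mem_head _ _).
  have dv : path_dominated (k v) (a v) by apply: dom; rewrite inE vL orbT.
  pose a' := upd a v ((a v).1 * (edge_step (a u)).1, (a v).2 * (edge_step (a u)).2).
  pose k' := upd k v (k v + (k u).+1)%N.
  have [z zL|s [s1 s2 s3]] := IHL a' k' eL.
    rewrite /k' /a' /upd /=; case: eqP => [_|_]; last by apply: dom; rewrite inE zL orbT.
    exact: path_dominated_mul (path_dominated_step _).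
  exists s; split.
  + by rewrite addnS s1.
  + have uniqL : uniq (unzip1 L).
      by elim: L eL {IHL dom uL vL s1 s2 s3} => //= -[x o] L IH /and3P[-> _ /IH].
    rewrite s2 big_cons !(big_rem v vL) /= /k' {1}/upd eqxx.
    rewrite [X in (_ + X + _)%N](_ : _ = \sum_(y <- rem v (unzip1 L)) k y)%N.
      by move: (\sum_(y <- rem v (unzip1 L)) k y)%N (size (edges_of L)) => z t; lia.
    apply: eq_big_seq => y; rewrite mem_rem_uniq // inE => /andP[ne _].
    by rewrite /upd (negPf ne).
  + rewrite -(@eq_value _ _ ends L (symmetric_weight \o a')) // => z _.
    rewrite /a' /upd /=; case: eqP => // _.
    by rewrite symmetric_weight_step.
- move=> /andP[uL eL] dom; have [a0 aa _ aq] := dom u (mem_head _ _).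
  have [z zL|s [s1 s2 /andP[s3 s4]]] := IHL a k eL.
    by apply: dom; rewrite inE zL orbT.
  have v0 : 0 <= nonempty_prob (symmetric_weight (a u)).
    by rewrite /nonempty_prob /=; lra.
  have vq : nonempty_prob (symmetric_weight (a u)) <= path_prob (k u).
    by move: aq; rewrite /nonempty_prob /=; lra.
  exists (k u :: s); split=> /=; first by rewrite addSn s1.
    by rewrite s2 big_cons addnA.
  by rewrite big_cons mulr_ge0 // ler_pM.
Qed.

End ValueBound.

(** * Leaf orders of a graph and the value of [q] *)

Section LeafOrders.
Variable G : sgraph.

Definition ends_of (e : edge G) : G * G := val e.

(** A vertex without neighbours in [A] qualifies too, as the last vertex of a tree must. *)
Definition leaf_in (A : {pred G}) (u : G) : Prop :=
  {in A &, forall v w, adj u v -> adj u w -> v = w}.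

Fixpoint leaf_order (s : seq G) : Prop :=
  if s is u :: s' then leaf_in (mem s') u /\ leaf_order s' else True.

Fixpoint leaf_elimination (s : seq G) : seq (G * option (G * edge G)) :=
  if s is u :: s' then
    (u, [pick p : G * edge G | (p.1 \in s') && joins ends_of p.2 u p.1])
      :: leaf_elimination s'
  else [::].

Lemma unzip1_leaf_elimination s : unzip1 (leaf_elimination s) = s.
Proof. by elim: s => //= u s ->. Qed.

Lemma leaf_elimination_valid s : uniq s -> elimination ends_of (leaf_elimination s).
Proof.
elim: s => //= u s IHs /andP[us /IHs ->].
by rewrite unzip1_leaf_elimination us; case: pickP => // -[v e] /= ->.
Qed.

Lemma joins_adj (e : edge G) u v : joins ends_of e u v -> adj u v.
Proof.
have /andP[h _] := valP e.
by case/orP => /eqP E; move: h; rewrite -[val e]/(ends_of e) E //= adj_sym.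
Qed.

(** Edges are stored with increasing [enum_rank], so opposite orientations cannot both occur. *)
Lemma joins_inj (e e' : edge G) u v :
  joins ends_of e u v -> joins ends_of e' u v -> e = e'.
Proof.
have /andP[_ h] := valP e; have /andP[_ h'] := valP e'.
by case/orP => /eqP E; case/orP => /eqP E'; apply: val_inj;
  move: h h'; rewrite -[val e]/(ends_of e) -[val e']/(ends_of e') E E' //= => h;
  rewrite ltnNge (ltnW h).
Qed.

(** An edge disappears with its earlier endpoint: that vertex has only one later neighbour, so the
    edge picked there is this one. *)
Lemma edges_of_leaf_elimination s e : leaf_order s ->
  (ends_of e).1 \in s -> (ends_of e).2 \in s ->
  e \in edges_of (leaf_elimination s).
Proof.
elim: s => //= u s IHs [lu ls].
have step v : joins ends_of e u v -> v \in s ->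
    e \in edges_of ((u, [pick p : G * edge G | (p.1 \in s) && joins ends_of p.2 u p.1])
      :: leaf_elimination s).
  move=> je vs; case: pickP => [[v' e'] /= /andP[v's je']|/(_ (v, e))]; last first.
    by rewrite /= vs je.
  have Ev : v' = v by apply: lu (joins_adj je') (joins_adj je).
  by rewrite Ev in je'; rewrite /edges_of /= inE (joins_inj je je') eqxx.
have /andP[adj_e _] := valP e.
rewrite !inE => /orP[/eqP E1|e1] /orP[/eqP E2|e2].
- by move: adj_e; rewrite -[val e]/(ends_of e) E1 E2 adj_irrefl.
- by apply: step e2; rewrite /joins -E1 -surjective_pairing eqxx.
- by apply: step e1; rewrite /joins -E2 -surjective_pairing eqxx orbT.
- by move: (IHs ls e1 e2); rewrite /edges_of /=; case: pickP => //= p _ h; rewrite inE h orbT.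
Qed.

Lemma edges_of_uniq (L : seq (G * option (G * edge G))) :
  elimination ends_of L -> uniq (edges_of L).
Proof.
elim: L => //= -[u [[v e]|]] L IHL /=; last by move=> /andP[_ /IHL].
move=> /and3P[uL /andP[vL je] eL]; rewrite [uniq _](IHL eL) andbT.
exact: edges_of_fresh eL uL je.
Qed.

Lemma size_edges_of_leaf_elimination s : uniq s -> (forall v, v \in s) ->
  leaf_order s -> size (edges_of (leaf_elimination s)) = #|edge G|.
Proof.
move=> us allv ls; have ue := edges_of_uniq (leaf_elimination_valid us).
rewrite -(card_uniqP ue); apply: eq_card => e.
by rewrite edges_of_leaf_elimination.
Qed.

Lemma q_leaf_order s : uniq s -> (forall v, v \in s) -> leaf_order s ->
  q G = value (leaf_elimination s) (symmetric_weight \o fun=> (1, 1)%R).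
Proof.
move=> us allv ls; rewrite /q; have vs := leaf_elimination_valid us.
(* Initially both values are allowed everywhere, which is the weight of the pair [(1, 1)]. *)
have /(_ (fun=> (true, true))) sumE := sum_eliminable _ vs.
rewrite (_ : #|[set f : system G | consistent f]|%:R%R =
   (\sum_(f : {ffun edge G -> {ffun 'F_2 * 'F_2 -> 'F_2}})
     (eliminable ends_of f (leaf_elimination s) (fun=> (true, true)))%:R)%R); last first.
  rewrite -sum1_card natr_sum big_mkcond /=; apply: eq_bigr => f _.
  rewrite inE; set b := consistent f.
  suff -> : b = eliminable ends_of f (leaf_elimination s) (fun=> (true, true)).
    by case: eliminable.
  apply/existsP/(eliminableP f (fun=> (true, true)) vs) => -[x xP]; exists x.
    split=> [v _|e _]; first by rewrite /allows; case: eqP.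
    exact: (forallP xP).
  apply/forallP => e; apply: (proj2 xP).
  exact: edges_of_leaf_elimination.
rewrite sumE mulrC mulrA mulVf ?mul1r //.
by rewrite pnatr_eq0 -lt0n; apply/card_gt0P; exists [ffun=> [ffun=> 0%R]].
Qed.

End LeafOrders.

(** * Leaf orders of forests and the upper bound *)

Section Forests.
Variable G : sgraph.

Lemma exists_leaf (S : {set G}) : cycle_free G -> S != set0 ->
  exists2 u, u \in S & leaf_in (mem S) u.
Proof.
move=> acyclic /set0Pn[x0 x0S].
pose leafb u := [forall v in S, forall w in S, adj u v ==> adj u w ==> (v == w)].
have leafP u : leafb u -> leaf_in (mem S) u.
  move=> /forall_inP h v w vS wS uv uw; have /forall_inP h' := h v vS.
  by have := h' w wS; rewrite uv uw => /eqP.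
have [/exists_inP[u uS /leafP]|/exists_inPn noleaf] := boolP [exists u in S, leafb u].
  by exists u.
(* Otherwise a longest path extends: its last vertex has a neighbour other than
   the previous vertex, and acyclicity makes this neighbour new. *)
suff [x [p [u_p _ _ sz]]] : exists x p, [/\ uniq (x :: p), path (@adj G) x p,
    {subset x :: p <= S} & size p = #|G|].
  by have := max_card (mem (x :: p)); rewrite (card_uniqP u_p) /= sz ltnn.
elim: #|G| => [|k [x [p [u_p path_p subS sz]]]].
  by exists x0, [::]; split=> // z; rewrite inE => /eqP->.
have xS : x \in S by apply: subS; rewrite mem_head.
(* For a one-vertex path the default of [head] is [x] itself, which is never its own neighbour. *)
have [y [yS xy ny]] : exists y, [/\ y \in S, adj x y & y != head x p].
  have := noleaf x xS; rewrite negb_forall_in => /exists_inP[v vS].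
  rewrite negb_forall_in => /exists_inP[w wS]; rewrite !negb_imply => /and3P[xv xw vw].
  have [Ev|nv] := eqVneq v (head x p); last by exists v.
  by exists w; rewrite -Ev eq_sym.
exists y, (x :: p); split=> /=; last by rewrite sz.
- rewrite -/(uniq (x :: p)) u_p andbT inE negb_or.
  apply/andP; split; first by apply: contraTneq xy => ->; rewrite adj_irrefl.
  apply/negP => yp; case/splitPr: yp u_p path_p ny => p1 p2.
  rewrite -cat_rcons -cat_cons cat_uniq cat_path => /andP[u1 _] /andP[path1 _].
  case: p1 u1 path1 => [|z p1] u1 path1; first by rewrite /= eqxx.
  have /acyclic : ucycle (@adj G) (x :: rcons (z :: p1) y).
    by rewrite /ucycle /cycle u1 rcons_path path1 last_rcons adj_sym xy.
  by rewrite /= size_rcons.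
- by rewrite adj_sym xy.
- by move=> z; rewrite inE => /orP[/eqP->|/subS].
Qed.

Lemma exists_leaf_order : cycle_free G ->
  exists s : seq G, [/\ uniq s, forall v, v \in s & leaf_order s].
Proof.
move=> acyclic.
suff [s [us sS ls]] : exists s : seq G, [/\ uniq s, s =i [set: G] & leaf_order s].
  by exists s; split=> // v; rewrite sS inE.
have [k] := ubnP #|[set: G]|; elim: k [set: G] => // k IHk S ltSk.
have [->|nzS] := eqVneq S set0; first by exists [::]; split=> // z; rewrite inE.
have [u uS lu] := exists_leaf acyclic nzS.
have [|s [us sS ls]] := IHk (S :\ u); first by move: ltSk; rewrite (cardsD1 u) uS; lia.
exists (u :: s); split=> /=.
- by rewrite us sS !inE eqxx.
- by move=> z; rewrite inE sS !inE; case: eqP => [->|].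
- by split=> // v w; rewrite /= !sS !inE => /andP[_ vS] /andP[_ wS]; apply: lu.
Qed.

Lemma exists_edge u v : adj u v -> exists e : edge G, joins (@ends_of G) e u v.
Proof.
move=> uv; have vu : adj v u by rewrite adj_sym.
have : enum_rank u != enum_rank v.
  by apply: contraTneq uv => /enum_rank_inj ->; rewrite adj_irrefl.
rewrite -val_eqE neq_ltn => /orP[h|h].
  by exists (Sub (u, v) (introT andP (conj uv h))); rewrite /joins /ends_of SubK eqxx.
by exists (Sub (v, u) (introT andP (conj vu h))); rewrite /joins /ends_of SubK eqxx orbT.
Qed.

Lemma no_isolated_card : no_isolated G -> #|G| <= 2 * #|edge G|.
Proof.
move=> noiso; pose h (p : bool * edge G) := if p.1 then (ends_of p.2).1 else (ends_of p.2).2.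
rewrite -card_bool -card_prod -[leqRHS]/(#|xpredT : pred (bool * edge G)|).
apply: leq_trans (leq_image_card h _); apply: subset_leq_card; apply/subsetP => v _.
have [w /exists_edge[e /orP[]/eqP E]] := noiso v; apply/imageP.
  by exists (true, e); rewrite // /h /= E.
by exists (false, e); rewrite // /h /= E.
Qed.

(** The elimination yields n - m trees with m edges in total; balancing their sizes only increases
    the product. *)
Lemma q_le_balanced n m : m < n -> #|G| = n -> #|edge G| = m -> cycle_free G ->
  (q G <= \prod_(m <= i < n) path_prob (i %/ (n - m)))%R.
Proof.
move=> ltmn Gn Gm acyclic; have [s [us alls ls]] := exists_leaf_order acyclic.
rewrite (q_leaf_order us alls ls).
have [|t [t1 t2 /andP[_ t3]]] := @value_le_paths _ _ _ _ (fun=> (1, 1)%R) (fun=> 0)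
  (leaf_elimination_valid us).
  by move=> v _; apply: path_dominated1.
apply: le_trans t3 _; move: t1 t2.
rewrite (size_edges_of_leaf_elimination us alls ls) Gm big1 // add0n.
rewrite -(size_map fst) -/(unzip1 _) unzip1_leaf_elimination -(card_uniqP us).
rewrite (eq_card (B := G)) ?Gn => [t1 t2|v]; last by rewrite alls.
have st : size t = n - m by lia.
have := @prod_path_prob_balanced t; rewrite st t2 subnKC ?(ltnW ltmn) //.
by apply; rewrite subn_gt0.
Qed.

End Forests.

(** * The extremal graph and its consistency probability *)

(* Joining i to i + k splits {0, ..., n - 1} into the paths formed by the
   residue classes modulo k. *)
Section StrideGraph.
Variables (n' k : nat).
Hypothesis k_gt0 : 0 < k.
Let n := n'.+1.

Definition stride_adj : rel 'I_n := fun i j => (j == i + k :> nat) || (i == j + k :> nat).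

Lemma stride_adj_sym : symmetric stride_adj.
Proof. by move=> i j; rewrite /stride_adj orbC. Qed.

Lemma stride_adj_irrefl : irreflexive stride_adj.
Proof. by move=> i; rewrite /stride_adj orbb; apply/negbTE/eqP; lia. Qed.

Definition stride_graph : sgraph := SGraph stride_adj_sym stride_adj_irrefl.

Let s i : seq stride_graph := drop i (enum 'I_n).

Lemma mem_drop_enum_ord i (j : 'I_n) : (j \in s i) = (i <= j).
Proof.
have := enum_uniq 'I_n; rewrite -(cat_take_drop i (enum 'I_n)) cat_uniq.
move=> /and3P[_ /hasPn disj _].
have := in_take i (mem_enum 'I_n j); rewrite index_enum_ord => tE.
have : j \in take i (enum 'I_n) ++ s i by rewrite cat_take_drop mem_enum.
rewrite mem_cat tE; case: (ltnP j i) => //= lt_ji _.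
by apply/negbTE/negP => /disj; rewrite /= tE lt_ji.
Qed.

Lemma drop_enum_ord (i : 'I_n) : s i = i :: s i.+1.
Proof.
by rewrite /s (drop_nth i) ?size_enum_ord // nth_ord_enum.
Qed.

(** In increasing order, the only later neighbour of [i] is [i + k]. *)
Lemma leaf_order_stride : leaf_order (s 0).
Proof.
have [d] := ubnP n; rewrite -[n]subn0; elim: d 0 => // d IHd i lt_d.
have [le_ni|lt_in] := leqP n i; first by rewrite /s drop_oversize // size_enum_ord.
rewrite (drop_enum_ord (Ordinal lt_in)) /=; split; last by apply: IHd; lia.
move=> v w vs ws.
have iv : i < v by rewrite -mem_drop_enum_ord.
have iw : i < w by rewrite -mem_drop_enum_ord.
rewrite /stride_adj /= => /orP[]/eqP /= h /orP[]/eqP /= h'; apply: ord_inj; lia.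
Qed.

Lemma stride_parent (i : 'I_n) :
  if [pick p : stride_graph * edge stride_graph |
        (p.1 \in s i.+1) && joins (@ends_of stride_graph) p.2 i p.1] is Some (v, e)
  then (v : 'I_n) = i + k :> nat else n <= i + k.
Proof.
case: pickP => [[v e] /= /andP[]|none].
  rewrite mem_drop_enum_ord => iv je.
  have := @joins_adj stride_graph e i v je.
  by rewrite /= /stride_adj => /orP[]/eqP /=; lia.
rewrite leqNgt; apply/negP => lt_n.
have [e je] : exists e, joins (@ends_of stride_graph) e i (Ordinal lt_n).
  by apply: exists_edge; rewrite /= /stride_adj /= eqxx.
by have := none (Ordinal lt_n, e); rewrite /= je mem_drop_enum_ord /=; lia.
Qed.

(** The state once all vertices below [i] are eliminated: a vertex below [i + k] has absorbed the
    [j %/ k] edges leading down its residue class. *)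
Definition stride_weight (i : nat) (j : stride_graph) : rat * rat :=
  if j < i + k then path_end (j %/ k) else path_end 0.

(** Exactly the vertices from [n - k] on have no successor; each closes a path and contributes its
    factor. *)
Lemma value_stride i :
  value (leaf_elimination (s i)) (symmetric_weight \o stride_weight i) =
    (\prod_(maxn i (n - k) <= l < n) path_prob (l %/ k))%R /\
  size (edges_of (leaf_elimination (s i))) = n - k - i.
Proof.
have [d] := ubnP (n - i); elim: d i => // d IHd i lt_d.
have [le_ni|lt_in] := leqP n i.
  rewrite /s drop_oversize ?size_enum_ord //= big_geq; last by lia.
  by split=> //; lia.
have [|IHv IHs] := IHd i.+1; first by lia.
rewrite (drop_enum_ord (Ordinal lt_in)) /=.
have := stride_parent (Ordinal lt_in); rewrite -/(s i.+1) /=.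
have us : uniq (s i.+1) by rewrite drop_uniq ?enum_uniq.
have step := leaf_elimination_valid us.
case: pickP => [[v e] /= _ vE|_ /= le_n].
  have lt_vn := ltn_ord v.
  split; last by rewrite /edges_of /= -/(edges_of _) IHs; lia.
  rewrite (_ : maxn i (n - k) = maxn i.+1 (n - k)); last by lia.
  rewrite -IHv; apply: (eq_value step) => z.
  rewrite unzip1_leaf_elimination mem_drop_enum_ord => lt_iz.
  rewrite /upd /= symmetric_weight_step /stride_weight.
  have [->|ne] := eqVneq z v; last first.
    have {}ne : nat_of_ord z != i + k by rewrite -vE.
    by congr symmetric_weight; congr (if _ then _ else _); lia.
  rewrite vE ltnn addSn ltnSn /= ifT; last by lia.
  rewrite divnDr // divnn k_gt0 addn1 path_endS /weight_mul /symmetric_weight /=.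
  by rewrite !mul1r.
split; last by rewrite /edges_of /= -/(edges_of _) IHs; lia.
rewrite (_ : maxn i (n - k) = i); last by lia.
rewrite big_ltn //; congr (_ * _)%R.
  by rewrite /stride_weight /nonempty_prob /= ifT /path_prob; [ring | lia].
rewrite (_ : maxn i.+1 (n - k) = i.+1) in IHv; last by lia.
rewrite -IHv; apply: (eq_value step) => z _ /=.
rewrite /stride_weight; congr symmetric_weight; congr (if _ then _ else _).
by have := ltn_ord z; lia.
Qed.

Lemma mem_s0 (v : stride_graph) : v \in s 0.
Proof. by rewrite mem_drop_enum_ord. Qed.

Lemma uniq_s0 : uniq (s 0).
Proof. by rewrite drop_uniq ?enum_uniq. Qed.

Lemma card_edge_stride : #|edge stride_graph| = n - k.
Proof.
rewrite -(size_edges_of_leaf_elimination uniq_s0 mem_s0 leaf_order_stride).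
by have [_ ->] := value_stride 0; rewrite subn0.
Qed.

Lemma q_stride : q stride_graph = (\prod_(n - k <= l < n) path_prob (l %/ k))%R.
Proof.
rewrite (q_leaf_order uniq_s0 mem_s0 leaf_order_stride).
have [] := value_stride 0; rewrite max0n => <- _.
apply: (eq_value (leaf_elimination_valid uniq_s0)) => z _ /=.
congr symmetric_weight; rewrite /stride_weight add0n.
by case: ltnP => // lt_zk; rewrite divn_small.
Qed.

Lemma cycle_free_stride : cycle_free stride_graph.
Proof.
move=> c; rewrite leqNgt => cyc; apply/negP => c3.
case: c cyc c3 => // x0 c0; set c := x0 :: c0 => cyc c3.
(* Starting from the least vertex [i] of the cycle, its successor and its predecessor must both be
   [i + k], so a cycle of length at least 3 repeats a vertex. *)
case: (arg_minnP (fun j : 'I_n => val j) (mem_head x0 c0)) => i ic imin.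
have [l c' rotE] := rot_to ic.
have : ucycle (@adj stride_graph) (i :: c') by rewrite -rotE rot_ucycle.
have : size (i :: c') = size c by rewrite -rotE size_rot.
have {}imin j : j \in c' -> i <= j.
  move=> jc; have : j \in rot l c by rewrite rotE inE jc orbT.
  by rewrite mem_rot; apply: imin.
case: c' imin {rotE} => [|x c']; first by move=> _ E; move: c3; rewrite -E.
case: (lastP c') => [|c'' y]; first by move=> _ E; move: c3; rewrite -E.
move=> imin _ /andP[]; rewrite /cycle /= !rcons_path last_rcons => /andP[ix /andP[_ yi]].
have le_ix : i <= x by apply: imin; rewrite mem_head.
have le_iy : i <= y by apply: imin; rewrite inE mem_rcons mem_head orbT.
rewrite /stride_adj in ix yi.
have -> : x = y by apply: ord_inj; case/orP: ix => /eqP; case/orP: yi => /eqP; lia.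
by rewrite mem_rcons mem_head /= andbF.
Qed.

Lemma no_isolated_stride : 2 * k <= n -> no_isolated stride_graph.
Proof.
move=> le_kn v; have [lt_n|le_n] := ltnP (v + k) n.
  by exists (Ordinal lt_n); rewrite /= /stride_adj /= eqxx.
have lt_v : v - k < n by have := ltn_ord v; lia.
by exists (Ordinal lt_v); rewrite /= /stride_adj /= subnK ?eqxx ?orbT //; lia.
Qed.

(** * Components of the stride graph *)

Hypothesis le_kn : k <= n.

(** The residue class of [r] in increasing order; the last vertex of the graph is [n'], whence the
    length. *)
Let stride_path r : seq stride_graph :=
  [seq inord (r + k * t) | t <- iota 0 ((n' - r) %/ k).+1].

Lemma stride_path_bound r t : r < k -> t < ((n' - r) %/ k).+1 -> r + k * t < n.
Proof. by move=> lt_rk; rewrite ltnS leq_divRL // => ?; rewrite /n; lia. Qed.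

Lemma nth_stride_path r t v0 : r < k -> t < ((n' - r) %/ k).+1 ->
  nth v0 (stride_path r) t = r + k * t :> nat.
Proof.
move=> lt_rk lt_t; rewrite (nth_map 0) ?size_iota // nth_iota // add0n inordK //.
exact: stride_path_bound.
Qed.

Lemma mem_stride_path r (w : 'I_n) : r < k ->
  (w \in stride_path r) = (w %% k == r).
Proof.
move=> lt_rk; apply/mapP/eqP => [[t]|wr].
  rewrite mem_iota add0n /= => lt_t ->; rewrite inordK; last exact: stride_path_bound.
  by rewrite mulnC addnC modnMDl modn_small.
have wE := divn_eq w k; have lt_w := ltn_ord w; rewrite wr in wE.
exists (w %/ k); last by apply: ord_inj; rewrite mulnC addnC -wE inord_val.
by rewrite mem_iota add0n /= ltnS leq_divRL //; lia.
Qed.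

Lemma uniq_stride_path r : r < k -> uniq (stride_path r).
Proof.
move=> lt_rk; rewrite map_inj_in_uniq ?iota_uniq // => t t'.
rewrite !mem_iota !add0n /= => lt_t lt_t' /(congr1 val).
rewrite /= !inordK; [|exact: stride_path_bound..].
by move/addnI/eqP; rewrite eqn_pmul2l // => /eqP.
Qed.

Lemma index_stride_path r (w : 'I_n) : r < k -> w \in stride_path r ->
  index w (stride_path r) = w %/ k.
Proof.
move=> lt_rk ws; have lt_i : index w (stride_path r) < ((n' - r) %/ k).+1.
  by rewrite -index_mem size_map size_iota in ws.
have := nth_stride_path w lt_rk lt_i; rewrite nth_index // => ->.
by rewrite mulnC addnC divnMDl // (divn_small lt_rk) addn0.
Qed.

Lemma connect_stride (v w : stride_graph) :
  connect (@adj stride_graph) v w = (w %% k == v %% k).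
Proof.
have cs := sym_connect_sym stride_adj_sym.
apply/idP/eqP => [|Evw].
  have cl : closed stride_adj [pred x : 'I_n | x %% k == v %% k].
    by move=> x y /orP[]/eqP /= E; rewrite !inE E modnDr.
  by move=> /(closed_connect cl); rewrite !inE eqxx => /esym/eqP.
have root (r : 'I_n) : r < k -> forall t (u : 'I_n), u = r + k * t :> nat ->
    connect stride_adj r u.
  move=> lt_rk; elim=> [|t IHt] u uE.
    by rewrite (_ : u = r) //; apply: ord_inj; rewrite uE muln0 addn0.
  have lt_u : r + k * t < n by have := ltn_ord u; rewrite uE mulnS; lia.
  apply: connect_trans (IHt (Ordinal lt_u) erefl) (connect1 _).
  by rewrite /stride_adj /= uE mulnS; apply/orP; left; apply/eqP; lia.
have lt_r : v %% k < n by apply: leq_trans le_kn; rewrite ltn_mod.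
have lt_rk : Ordinal lt_r < k by rewrite /= ltn_mod.
apply: (@connect_trans _ _ (Ordinal lt_r : stride_graph)).
  rewrite cs; apply: (root _ lt_rk (v %/ k)).
  by rewrite /= addnC mulnC -divn_eq.
apply: (root _ lt_rk (w %/ k)).
by rewrite /= -Evw addnC mulnC -divn_eq.
Qed.

Lemma components_stride (T : {set stride_graph}) : T \in components stride_graph ->
  exists2 r, r < k & stride_path r =i T.
Proof.
move=> /imsetP[v _ ->]; exists (v %% k); first by rewrite ltn_mod.
by move=> w; rewrite mem_stride_path ?ltn_mod // inE connect_stride.
Qed.

Lemma induces_path_stride (T : {set stride_graph}) : T \in components stride_graph ->
  induces_path T.
Proof.
move=> /components_stride[r lt_rk sT].
exists (stride_path r); split=> //; first exact: uniq_stride_path.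
move=> v w; rewrite -!sT => vs ws; rewrite !index_stride_path //.
move: vs ws; rewrite !mem_stride_path // => /eqP vr /eqP wr.
(* Within a residue class, differing by [k] means having consecutive quotients, which are the
   positions in the path. *)
have succE a b : a %% k = r -> b %% k = r -> (a == b + k) = (a %/ k == (b %/ k).+1).
  move=> ar br; rewrite {1}(divn_eq a k) {1}(divn_eq b k) ar br addnAC eqn_add2r.
  by rewrite -mulSnr eqn_pmul2r.
by rewrite /= /stride_adj (succE w v) // (succE v w).
Qed.

Lemma card_component_stride (T : {set stride_graph}) : T \in components stride_graph ->
  exists2 r, r < k & #|T| = ((n' - r) %/ k).+1.
Proof.
move=> /components_stride[r lt_rk sT]; exists r => //.
by rewrite -(eq_card sT) (card_uniqP (uniq_stride_path lt_rk)) size_map size_iota.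
Qed.

Lemma components_stride_balanced (Ti Tj : {set stride_graph}) :
  Ti \in components stride_graph -> Tj \in components stride_graph ->
  `| #|Ti| - #|Tj| |%N <= 1.
Proof.
move=> /card_component_stride[r lt_r ->] /card_component_stride[t lt_t ->].
have le a b : a < k -> b < k -> (n' - a) %/ k <= ((n' - b) %/ k).+1.
  move=> lt_a lt_b; have : n' - a <= n' - b + k by lia.
  by move/(leq_div2r k); rewrite divnDr // divnn k_gt0 addn1.
by have := le r t lt_r lt_t; have := le t r lt_t lt_r; lia.
Qed.

End StrideGraph.

Theorem theorem19 (n m : nat) (hmn : m < n)
    (hex : exists G : sgraph, admissible n m G) :
  exists G : sgraph,
    [/\ admissible n m G,
        forall H : sgraph, admissible n m H -> (q H <= q G)%R,
        forall T : {set G}, T \in components G -> induces_path T &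
        forall Ti Tj : {set G}, Ti \in components G -> Tj \in components G ->
          `| #|Ti| - #|Tj| |%N <= 1].
Proof.
case: n hmn hex => // n' hmn [G0 [G0n G0m _ G0iso]].
have k_gt0 : 0 < n'.+1 - m by rewrite subn_gt0.
have le_kn : n'.+1 - m <= n'.+1 by rewrite leq_subr.
have nm : n'.+1 - (n'.+1 - m) = m by rewrite subKn // ltnW.
(* The given admissible graph forces n <= 2m, so every residue class modulo n - m has at least two
   vertices. *)
have le_2k : 2 * (n'.+1 - m) <= n'.+1.
  by have := no_isolated_card G0iso; rewrite G0n G0m; lia.
exists (stride_graph n' k_gt0); split.
- split; [by rewrite card_ord | by rewrite card_edge_stride nm | |].
    exact: cycle_free_stride.
  exact: no_isolated_stride.
- move=> H [Hn Hm Hacyclic _]; rewrite q_stride nm.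
  exact: q_le_balanced.
- exact: induces_path_stride.
- exact: components_stride_balanced.
Qed.
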